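(* Let $A\in\mathbb{R}^{m\times n}$ and $b\in\mathbb{R}^m$ be partitioned as $$A=\mathrm{col}(A_1,\dots,A_c),\qquad A_i=[A_{i1},A_{i2},\dots,A_{ic_i}],\qquad b=\mathrm{col}(b_1,\dots,b_c),\qquad b_i=\sum_{j=1}^{c_i}b_{ij},$$ with $A_i\in\mathbb{R}^{m_i\times n}$, $A_{ij}\in\mathbb{R}^{m_i\times n_{ij}}$, $b_i,b_{ij}\in\mathbb{R}^{m_i}$, $\sum_{i=1}^c m_i=m$, and $\sum_{j=1}^{c_i}n_{ij}=n$ for every $i\in\{1,\dots,c\}$. Suppose that the cluster graph $\mathbb{G}$ is undirected and connected and that, for every $i\in\{1,\dots,c\}$, the graph $\mathbb{G}_i$ is undirected and connected. Consider the dynamics, for all $i\in\{1,\dots,c\}$, $j\in\{1,\dots,c_i\}$ and $t\ge0$, $$\dot x_{ij}=-\Big(c_iA_{ij}^Ty_{ij}-\sum_{k\in\mathcal{N}_i}(z_{ij}-E_{ij}\bar z_k)\Big)-\sum_{k\in\mathcal{N}_i}(x_{ij}-E_{ij}\bar x_k),$$ $$\dot\xi_{ij}=-\sum_{i_k\in\mathcal{N}_{ij}}(y_{ij}-y_{ik}),\qquad y_{ij}=\xi_{ij}+A_{ij}x_{ij}-b_{ij},$$ $$\dot z_{ij}=c_iA_{ij}^Ty_{ij}-\sum_{k\in\mathcal{N}_i}(z_{ij}-E_{ij}\bar z_k),$$ with states $x_{ij},z_{ij}\in\mathbb{R}^{n_{ij}}$, $\xi_{ij}\in\mathbb{R}^{m_i}$,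 where $\bar x_k=\mathrm{col}(x_{k1},\dots,x_{kc_k})\in\mathbb{R}^n$ and $\bar z_k=\mathrm{col}(z_{k1},\dots,z_{kc_k})\in\mathbb{R}^n$, with initial values $\xi_{ij}(0)=0$ for all $i,j$ and arbitrary initial values $x_{ij}(0),z_{ij}(0)$. Then every $x_{ij}(t)$ converges exponentially, as $t\to\infty$, to a constant vector $x^*_{ij}\in\mathbb{R}^{n_{ij}}$, and, with $\bar x^*_i=\mathrm{col}(x^*_{i1},\dots,x^*_{ic_i})\in\mathbb{R}^n$, these vectors satisfy: (i) $\bar x^*_1=\bar x^*_2=\dots=\bar x^*_c=:x^*$; (ii) $\sum_{i=1}^cA_i^T(A_ix^*-b_i)=0$; so that $x^*$ is a least square solution of $Ax=b$. Moreover, $x^*$ is an exact solution of $Ax=b$ (i.e. $Ax^*=b$) if and only if $\lim_{t\to\infty}\hat y(t)=0$, where $\hat y=\mathrm{col}(\bar y_1,\dots,\bar y_c)$ and $\bar y_i=\mathrm{col}(y_{i1},\dots,y_{ic_i})$.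
   Context: The network is double-layered: there are $c$ clusters, and cluster $i$ consists of $c_i$ agents $i_1,\dots,i_{c_i}$. $\mathbb{G}$ is a graph on the set of clusters $\{1,\dots,c\}$, and $\mathcal{N}_i$ is the set of neighbors of cluster $i$ in $\mathbb{G}$. For each $i$, $\mathbb{G}_i$ is a graph on the agents $\{i_1,\dots,i_{c_i}\}$ of cluster $i$, and $\mathcal{N}_{ij}$ is the set of neighbors $i_k$ of agent $i_j$ in $\mathbb{G}_i$. Edges are unweighted. The matrices $E_{ij}\in\mathbb{R}^{n_{ij}\times n}$ form a row partition of the identity: $\mathrm{col}(E_{i1},\dots,E_{ic_i})=I_n$ for each $i$. $\mathrm{col}(\cdot)$ denotes the column stack of blocks. A least square solution of $Ax=b$ is a minimizer of $\|Ax-b\|^2$ over $x\in\mathbb{R}^n$ (Euclidean norm), equivalently a vector $x^*$ with $A^T(Ax^*-b)=0$. ''$x(t)$ converges exponentially to $x^*$'' means that there exist constants $C\ge 0$ and $\alpha>0$ with $\|x(t)-x^*\|\le Ce^{-\alpha t}$ for all $t\ge0$. The limits may depend on the initial values. *)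

(* Defs.v *)
From HB Require Import structures.
From mathcomp Require Import all_boot all_order all_algebra.
From mathcomp Require Import all_classical all_reals all_analysis.
Import Order.TTheory GRing.Theory Num.Theory.
Import numFieldNormedType.Exports.

Set Implicit Arguments.
Unset Strict Implicit.
Unset Printing Implicit Defensive.

Local Open Scope classical_set_scope.
Local Open Scope ring_scope.

(* Loops are allowed: they contribute nothing to the sums of differences over
   neighbours in which the relation is used. *)
Definition undirected_connected (V : finType) (e : rel V) : Prop :=
  symmetric e /\ forall u v : V, connect e u v.

(* Block stacks whose total size is only propositionally equal to n: the
   block matrices of the library have the sum of the block sizes as dimension. *)
Definition colstack (T : Type) (k n p : nat) (d : 'I_k -> nat)
    (dn : (\sum_(i < k) d i)%N = n)
    (B : forall i : 'I_k, 'M[T]_(d i, p)) : 'M[T]_(n, p) :=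
  castmx (dn, erefl p) (\mxcol_(i < k) B i).

Definition rowstack (T : Type) (k n p : nat) (d : 'I_k -> nat)
    (dn : (\sum_(i < k) d i)%N = n)
    (B : forall i : 'I_k, 'M[T]_(p, d i)) : 'M[T]_(p, n) :=
  castmx (erefl p, dn) (\mxrow_(i < k) B i).

(* The norm `|v| provided on matrices by the library is the max norm. *)
Definition enorm (R : realType) (n : nat) (v : 'cV[R]_n) : R :=
  Num.sqrt (\sum_(k < n) v k ord0 ^+ 2).

(* Derivative at t >= 0 of the restriction of f to [0, +oo[: the two-sided
   derivative if 0 < t and the right derivative if t = 0. *)
Definition is_deriv_ge0 (R : realType) (n : nat) (f : R -> 'cV[R]_n)
    (t : R) (v : 'cV[R]_n) : Prop :=
  h^-1 *: (f (t + h) - f t) @[h --> within [set h | 0 <= t + h] 0^'] --> v.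

Definition exp_cvg (R : realType) (n : nat) (f : R -> 'cV[R]_n)
    (l : 'cV[R]_n) : Prop :=
  exists C alpha : R, [/\ 0 <= C, 0 < alpha &
    forall t : R, 0 <= t -> enorm (f t - l) <= C * expR (- alpha * t)].

Definition least_square_solution (R : realType) (m n : nat)
    (A : 'M[R]_(m, n)) (b : 'cV[R]_m) (x : 'cV[R]_n) : Prop :=
  forall v : 'cV[R]_n, enorm (A *m x - b) ^+ 2 <= enorm (A *m v - b) ^+ 2.

(* Main.v *)
(* Write K = G^T G and L = H^T H for the stacked Laplacians of the agent graphs
   and of the cluster graph, G and H being incidence matrices, and stack the
   variables, those of cluster i with indices (i, j) in xi and y being scaled by
   sqrt c_i.  As xi(0) = 0 and xi' = - K y, one can write xi = - G^T eta with
   eta' = G y.  In the variables (x, eta, x + z) the dynamics become s' = M s + f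
   with <s, M s> = - |D x - G^T eta|^2 - 2 |H x|^2 <= 0.  Dissipativity gives
   ker M = ker M^T and ker M^2 = ker M, so f, which is orthogonal to ker M, lies
   in the range of M, and the velocity r = M s + f obeys r' = M r inside that
   range.  With Q = - (M + M^T), the form |r|^2 - eps <Q r, Q M r> is a strict
   Lyapunov function for r, because Q u = 0 and Q M u = 0 imply M u = 0.  Hence r
   decays exponentially and s converges exponentially to an equilibrium, which
   connectivity of the graphs identifies with a solution of the normal
   equations. *)
Require Import Defs.
From HB Require Import structures.
From mathcomp Require Import all_boot all_order all_algebra.
From mathcomp Require Import all_classical all_reals all_analysis.
From mathcomp Require Import ring lra.
Import Order.TTheory GRing.Theory Num.Theory.
Import numFieldNormedType.Exports.
Set Implicit Arguments.
Unset Strict Implicit.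
Unset Printing Implicit Defensive.
Local Open Scope classical_set_scope.
Local Open Scope ring_scope.

(** * Coordinatewise limits and the calculus of derivatives on the half-line *)

Lemma cvg_mxP (R : realType) (T : Type) (F : set_system T) (FF : Filter F)
    (m n : nat) (f : T -> 'M[R]_(m, n)) (l : 'M[R]_(m, n)) :
  f @ F --> l <-> forall i j, f x i j @[x --> F] --> l i j.
Proof.
split=> [fl i j|fl].
  apply: (@cvg_comp _ _ _ f (fun M : 'M[R]_(m, n) => M i j) F (nbhs l)).
    exact: fl.
  exact: coord_continuous.
move=> U [P lP PU]; rewrite nbhs_filterE.
apply: (@filterS _ F FF (fun x => forall i j, P i j (f x i j))) => [x Px|].
  exact: PU.
by apply: filter_forall => i; apply: filter_forall => j; exact: fl (lP i j).
Qed.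

Section OneSidedDerivative.
Context {R : realType}.
Implicit Types (f g : R -> R) (t u v : R).

Definition deriv_ge0 f t v : Prop :=
  h^-1 * (f (t + h) - f t) @[h --> within [set h | 0 <= t + h] 0^'] --> v.

Lemma is_deriv_ge0P (n : nat) (f : R -> 'cV[R]_n) t (v : 'cV[R]_n) :
  is_deriv_ge0 f t v <->
  forall k, deriv_ge0 (fun s => f s k ord0) t (v k ord0).
Proof.
rewrite /is_deriv_ge0 cvg_mxP; split=> [H k|H i j].
  by have := H k ord0; rewrite /deriv_ge0; under eq_cvg do rewrite !mxE.
by rewrite ord1; under eq_cvg do rewrite !mxE; exact: H.
Qed.

Lemma deriv_ge0_cst t (a : R) : deriv_ge0 (fun=> a) t 0.
Proof.
by rewrite /deriv_ge0; under eq_cvg do rewrite subrr mulr0; exact: cvg_cst.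
Qed.

Lemma deriv_ge0D f g t u v : deriv_ge0 f t u -> deriv_ge0 g t v ->
  deriv_ge0 (fun s => f s + g s) t (u + v).
Proof.
move=> fu gv; rewrite /deriv_ge0.
under eq_cvg do rewrite opprD addrACA mulrDr.
exact: cvgD fu gv.
Qed.

Lemma deriv_ge0Z (a : R) f t v : deriv_ge0 f t v ->
  deriv_ge0 (fun s => a * f s) t (a * v).
Proof.
move=> fv; rewrite /deriv_ge0; under eq_cvg do rewrite -mulrBr mulrCA.
by apply: cvgM fv; exact: cvg_cst.
Qed.

Lemma deriv_ge0_sum (I : Type) (r : seq I) (P : pred I) (f : I -> R -> R) t
    (v : I -> R) : (forall i, P i -> deriv_ge0 (f i) t (v i)) ->
  deriv_ge0 (fun s => \sum_(i <- r | P i) f i s) t (\sum_(i <- r | P i) v i).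
Proof.
move=> fv; elim: r => [|i r IH].
  rewrite big_nil /deriv_ge0; under eq_cvg do rewrite !big_nil subrr mulr0.
  exact: cvg_cst.
rewrite big_cons /deriv_ge0; under eq_cvg do rewrite !big_cons.
by case: ifP => // /fv fi; exact: deriv_ge0D fi IH.
Qed.

(** For h != 0, f (t + h) is h times the difference quotient plus f t, and the first summand tends
    to 0. *)
Lemma deriv_ge0_cvg f t v : deriv_ge0 f t v ->
  f (t + h) @[h --> within [set h | 0 <= t + h] 0^'] --> f t.
Proof.
move=> fv.
have h0 : h @[h --> within [set h | 0 <= t + h] 0^'] --> (0 : R).
  move=> A A0; apply: (@cvg_within _ 0^'); exact: (@cvg_within _ (nbhs (0 : R))).
have H : h * (h^-1 * (f (t + h) - f t)) + f t
    @[h --> within [set h | 0 <= t + h] 0^'] --> f t.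
  rewrite -[X in _ --> X]add0r -[X in _ --> X + _](mul0r v).
  by apply: cvgD; [exact: cvgM|exact: cvg_cst].
move: H; apply: cvg_trans; apply: near_eq_cvg; near=> h.
have h_neq0 : h != 0 by near: h; apply: (@cvg_within _ 0^'); exact: withinT.
by rewrite mulrA divff// mul1r subrK.
Unshelve. all: by end_near. Qed.

Lemma deriv_ge0M f g t u v : deriv_ge0 f t u -> deriv_ge0 g t v ->
  deriv_ge0 (fun s => f s * g s) t (u * g t + f t * v).
Proof.
move=> fu gv; have fc := deriv_ge0_cvg fu; rewrite /deriv_ge0.
have -> : (fun h => h^-1 * (f (t + h) * g (t + h) - f t * g t)) =
    (fun h => h^-1 * (f (t + h) - f t) * g t +
              f (t + h) * (h^-1 * (g (t + h) - g t))).
  by apply/funext => h; ring.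
by apply: cvgD; apply: cvgM => //; exact: cvg_cst.
Qed.

(** When 0 < t, the constraint 0 <= t + h holds for all small h, so the restricted filter and the
    punctured neighbourhood filter have the same members. *)
Lemma deriv_ge0_is_derive f t v : 0 < t -> deriv_ge0 f t v <-> is_derive t 1 f v.
Proof.
move=> t0.
have H (A : set R) : within [set h | 0 <= t + h] 0^' A <-> 0^' A.
  split=> [HA|]; last exact: cvg_within.
  suff : \forall h \near (0 : R)^', 0 <= t + h.
    by move=> H; apply: (@filterS2 _ (0 : R)^' _
      (fun h => 0 <= t + h -> A h) (fun h => 0 <= t + h) A) => // h; apply.
  apply: (@cvg_within _ (nbhs (0 : R))).
  exists t => //= h; rewrite /= sub0r normrN => ht.
  by have := ler_norm (- h); rewrite normrN; move: ht; lra.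
have -> : deriv_ge0 f t v <->
    (h^-1 *: ((f \o shift t) (h *: 1) - f t) @[h --> 0^'] --> v).
  rewrite /deriv_ge0.
  have -> : (fun h => h^-1 *: ((f \o shift t) (h *: 1) - f t)) =
    (fun h => h^-1 * (f (t + h) - f t)).
    by apply/funext => h /=; rewrite [h *: 1]mulr1 (addrC h).
  by split=> L A vA; apply/(H (_ @^-1` A)); exact: L.
split=> [fv|[dv <-]]; last exact: dv.
by split; [apply/cvg_ex; exists v|exact: cvg_lim fv].
Qed.

Lemma deriv_ge0_at_right f v : deriv_ge0 f 0 v -> f h @[h --> 0^'+] --> f 0.
Proof.
move=> /deriv_ge0_cvg; under eq_cvg do rewrite add0r.
move=> fc A fA; have := fc A fA.
apply: (@filterS _ (nbhs (0 : R))) => h H h0.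
by apply: H => /=; [rewrite gt_eqF|rewrite add0r ltW].
Qed.

(** The sign of the derivative at positive times decides; at 0 the one-sided derivative supplies the
    right continuity that a closed interval requires. *)
Lemma deriv_ge0_nincr f (df : R -> R) :
    (forall t, 0 <= t -> deriv_ge0 f t (df t)) ->
    (forall t, 0 <= t -> df t <= 0) ->
  forall s t, 0 <= s -> s <= t -> f t <= f s.
Proof.
move=> fdf df0 s t s0 st.
have dv (r : R) : 0 < r -> is_derive r 1 f (df r).
  by move=> r0; apply/(deriv_ge0_is_derive _ _ r0)/fdf/ltW.
(* The right end [t + 1] keeps the interval nondegenerate when t = 0. *)
apply: (@ler0_derive1_le_cc R f 0 (t + 1)) => //.
- by move=> r; rewrite in_itv/= => /andP[r0 _]; have [] := dv _ r0.
- move=> r; rewrite in_itv/= => /andP[r0 _]; have [_] := dv _ r0.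
  by rewrite derive1E => ->; exact/df0/ltW.
- have cont (r : R) : 0 < r -> {for r, continuous f}.
    move=> r0; apply: differentiable_continuous.
    by apply/derivable1_diffP; have [] := dv _ r0.
  apply/continuous_within_itvP; first by lra.
  split.
  + by move=> r; rewrite in_itv/= => /andP[r0 _]; exact: cont.
  + exact: deriv_ge0_at_right (fdf 0 (lexx 0)).
  + by apply: cvg_at_left_filter; apply: cont; lra.
- by rewrite in_itv/=; lra.
- by rewrite in_itv/=; lra.
Qed.

Lemma deriv_ge0_expR (a t : R) :
  0 <= t -> deriv_ge0 (fun s => expR (a * s)) t (a * expR (a * t)).
Proof.
move=> t0.
have dv (r : R) :
    is_derive r (1 : R) (fun s => expR (a * s)) (a * expR (a * r)).
  have da : is_derive r (1 : R) (a \*: (id : R -> R)) (a *: (1 : R)) by exact: is_deriveZ.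
  have := is_derive1_comp (is_derive_expR ((a \*: (id : R -> R)) r)) da.
  by rewrite [a *: 1]mulr1 mulrC.
suff H : h^-1 *: (expR (a * (h *: 1 + t)) - expR (a * t))
    @[h --> (0 : R)^'] --> a * expR (a * t).
  rewrite /deriv_ge0; apply: cvg_within_filter.
  move: H; apply: cvg_trans; apply: near_eq_cvg; near=> h.
  by rewrite /GRing.scale /= mulr1 (addrC h).
by have [d1 <-] := dv t; exact: d1.
Unshelve. all: by end_near. Qed.

End OneSidedDerivative.

(** * Exponential convergence of real functions *)

Section ExponentialConvergence.
Context {R : realType}.
Implicit Types (f g : R -> R) (a l C : R).

Definition exp_cvg1 f l : Prop := exists C a, [/\ 0 <= C, 0 < a &
  forall t, 0 <= t -> `|f t - l| <= C * expR (- a * t)].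

Lemma eq_exp_cvg1 f g l : (forall t, 0 <= t -> f t = g t) ->
  exp_cvg1 f l -> exp_cvg1 g l.
Proof.
move=> fg [C [a [C0 a0 H]]]; exists C, a; split=> // t t0.
by rewrite -fg//; exact: H.
Qed.

Lemma exp_cvg1_cst l : exp_cvg1 (fun=> l) l.
Proof.
by exists 0, 1; split=> // t _; rewrite subrr normr0 mul0r.
Qed.

Lemma exp_cvg1D f g l l' : exp_cvg1 f l -> exp_cvg1 g l' ->
  exp_cvg1 (fun t => f t + g t) (l + l').
Proof.
move=> [C [a [C0 a0 H]]] [C' [a' [C'0 a'0 H']]].
exists (C + C'), (Num.min a a'); split; first exact: addr_ge0.
  by rewrite lt_min a0 a'0.
move=> t t0; rewrite opprD addrACA (le_trans (ler_normD _ _))// mulrDl lerD//.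
- apply: le_trans (H t t0) _; rewrite ler_wpM2l// ler_expR ler_wpM2r//.
  by rewrite lerN2 ge_min lexx.
- apply: le_trans (H' t t0) _; rewrite ler_wpM2l// ler_expR ler_wpM2r//.
  by rewrite lerN2 ge_min lexx orbT.
Qed.

Lemma exp_cvg1Z c f l : exp_cvg1 f l -> exp_cvg1 (fun t => c * f t) (c * l).
Proof.
move=> [C [a [C0 a0 H]]]; exists (`|c| * C), a; split=> //.
  exact: mulr_ge0.
by move=> t t0; rewrite -mulrBr normrM -mulrA ler_wpM2l// H.
Qed.

Lemma exp_cvg1_sum (I : Type) (r : seq I) (P : pred I) (f : I -> R -> R)
    (l : I -> R) : (forall i, P i -> exp_cvg1 (f i) (l i)) ->
  exp_cvg1 (fun t => \sum_(i <- r | P i) f i t) (\sum_(i <- r | P i) l i).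
Proof.
move=> fl; elim: r => [|i r IH].
  rewrite big_nil; apply: eq_exp_cvg1 (exp_cvg1_cst 0) => t _.
  by rewrite big_nil.
rewrite big_cons; case: ifP => Pi.
  apply: eq_exp_cvg1 (exp_cvg1D (fl i Pi) IH) => t _.
  by rewrite big_cons Pi.
by apply: eq_exp_cvg1 IH => t _; rewrite big_cons Pi.
Qed.

(** Since 1 + a t < e^(a t), the bound C e^(-a t) is at most [e] as soon as C / (a e) <= t. *)
Lemma exp_cvg1_cvg f l : exp_cvg1 f l -> f t @[t --> +oo] --> l.
Proof.
move=> [C [a [C0 a0 H]]]; apply/cvgrPdist_le => e e0; near=> t.
have t0 : 0 < t by near: t; exact: nbhs_pinfty_gt.
rewrite distrC (le_trans (H t (ltW t0)))//.
have : C / (a * e) <= t by near: t; apply: nbhs_pinfty_ge; exact: num_real.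
rewrite ler_pdivrMr ?mulr_gt0// => Cle.
rewrite mulNr expRN ler_pdivrMr ?expR_gt0//.
have /ltW := expR_gt1Dx (lt0r_neq0 (mulr_gt0 a0 t0)).
rewrite -(ler_pM2l e0); apply: le_trans.
by rewrite mulrDr mulr1; move: Cle; lra.
Unshelve. all: by end_near. Qed.

Lemma exp_cvg1_unique f l l' : exp_cvg1 f l -> exp_cvg1 f l' -> l = l'.
Proof.
by move=> /exp_cvg1_cvg fl /exp_cvg1_cvg fl'; exact: cvg_unique fl fl'.
Qed.

(** Gronwall's argument: f t times e^(a t) is nonincreasing. *)
Lemma deriv_ge0_decay f (df : R -> R) a :
    (forall t, 0 <= t -> deriv_ge0 f t (df t)) ->
    (forall t, 0 <= t -> df t <= - a * f t) ->
  forall t, 0 <= t -> f t <= f 0 * expR (- a * t).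
Proof.
move=> fdf dfa t t0.
have := @deriv_ge0_nincr R (fun t => f t * expR (a * t)) _
  (fun t t0 => deriv_ge0M (fdf t t0) (@deriv_ge0_expR _ a _ t0)) _ 0 t (lexx _) t0.
rewrite mulr0 expR0 mulr1 mulNr expRN ler_pdivlMr ?expR_gt0//; apply.
move=> s s0; have := dfa s s0; have := expR_gt0 (a * s); nra.
Qed.

(** A quadratic Lyapunov function bounds squares; taking the root halves the rate. *)
Lemma exp_cvg1_sqr f C a : 0 < a ->
    (forall t, 0 <= t -> f t ^+ 2 <= C * expR (- a * t)) -> exp_cvg1 f 0.
Proof.
move=> a0 H; have C0 : 0 <= C.
  by have := H 0 (lexx _); rewrite mulr0 expR0 mulr1; apply: le_trans; exact: sqr_ge0.
exists (Num.sqrt C), (a / 2); split; rewrite ?sqrtr_ge0//; first by lra.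
move=> t t0; rewrite subr0.
rewrite -(@ler_pXn2r _ 2)// ?nnegrE ?mulr_ge0 ?sqrtr_ge0 ?expR_ge0//.
rewrite real_normK ?num_real// exprMn sqr_sqrtr// -expRM_natl.
by rewrite (_ : 2%:R * _ = - a * t) ?H//; field.
Qed.

(* [f - (C/a) e^(-at)] is nondecreasing and [f + (C/a) e^(-at)] nonincreasing,
   and they enclose the limit. *)
Lemma exp_cvg1_deriv f (df : R -> R) :
  (forall t, 0 <= t -> deriv_ge0 f t (df t)) -> exp_cvg1 df 0 ->
  exists l, exp_cvg1 f l.
Proof.
move=> fdf [C [a [C0 a0 H]]].
pose e t := C / a * expR (- a * t).
have de t : 0 <= t -> deriv_ge0 e t (- (C * expR (- a * t))).
  move=> t0; have := @deriv_ge0Z _ (C / a) _ _ _ (@deriv_ge0_expR _ (- a) _ t0).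
  by rewrite mulrA (_ : C / a * - a = - C) ?mulNr//; field; rewrite gt_eqF.
have e0 t : 0 <= e t by rewrite /e !mulr_ge0 ?invr_ge0 ?expR_ge0// ltW.
have dfC t : 0 <= t -> `|df t| <= C * expR (- a * t).
  by move=> t0; have := H t t0; rewrite subr0.
have up s t : 0 <= s -> s <= t -> f t + e t <= f s + e s.
  apply: (deriv_ge0_nincr (fun t t0 => deriv_ge0D (fdf t t0) (de t t0))) => r r0.
  by have := dfC r r0; have := ler_norm (df r); lra.
have dn s t : 0 <= s -> s <= t -> e t + - 1 * f t <= e s + - 1 * f s.
  apply: (deriv_ge0_nincr
    (fun t t0 => deriv_ge0D (de t t0) (@deriv_ge0Z _ (- 1) _ _ _ (fdf t t0)))) => r r0.
  by have := dfC r r0; have := ler_norm (- df r); rewrite normrN; lra.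
have le s t : 0 <= s -> 0 <= t -> f s - e s <= f t + e t.
  move=> s0 t0; have [st|/ltW ts] := leP s t.
    by have := dn s t s0 st; have := e0 t; lra.
  by have := up t s t0 ts; have := e0 s; lra.
pose A := [set f s - e s | s in [set s | 0 <= s]].
have A0 : A !=set0 by exists (f 0 - e 0), 0 => //=.
have Aub t : 0 <= t -> ubound A (f t + e t) by move=> t0 _ [s s0 <-]; exact: le.
exists (sup A), (C / a), a; split=> //; first by rewrite divr_ge0// ltW.
move=> t t0; rewrite -/(e t) ler_norml.
have l1 : sup A <= f t + e t by apply: ge_sup => //; exact: Aub.
have l2 : f t - e t <= sup A.
  by apply: ub_le_sup; [exists (f 0 + e 0); exact: Aub|exists t].
by apply/andP; split; lra.
Qed.

(** The Euclidean norm is at most the sum of the absolute values of the coordinates, so the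
    constants add up and a common lower bound of the rates serves. *)
Lemma exp_cvg_coord (n : nat) (f : R -> 'cV[R]_n) (l : 'cV[R]_n) :
  (forall k, exp_cvg1 (fun t => f t k ord0) (l k ord0)) -> exp_cvg f l.
Proof.
move=> fl.
have [C H] := choice fl; have [a {}H] := choice H.
(* The default value 1 gives a positive rate also when n = 0. *)
pose a0 := \big[Num.min/1]_k a k.
have a00 : 0 < a0.
  rewrite /a0; elim/big_ind: _ => // [x y x0 y0|k _]; first by rewrite lt_min x0.
  by case: (H k).
exists (\sum_k C k), a0; split=> //.
  by apply: sumr_ge0 => k _; case: (H k).
move=> t t0; rewrite mulr_suml.
apply: (@le_trans _ _ (\sum_k `|(f t - l) k ord0|)).
  have [S0 sqS] : 0 <= \sum_k `|(f t - l) k ord0| /\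
      \sum_k (f t - l) k ord0 ^+ 2 <= (\sum_k `|(f t - l) k ord0|) ^+ 2.
    apply: (big_ind2 (fun y x : R => 0 <= x /\ y <= x ^+ 2)).
    - by rewrite expr0n.
    - move=> x y x' y' [x0 xy] [x'0 xy']; split; first exact: addr_ge0.
      by move: (mulr_ge0 x0 x'0) xy xy'; rewrite sqrrD; lra.
    - by move=> k _; rewrite normr_ge0 real_normK ?num_real.
  by rewrite /enorm -[leRHS]ger0_norm// -sqrtr_sqr ler_wsqrtr.
apply: ler_sum => k _; have [Ck0 ak0 Hk] := H k.
rewrite !mxE; apply: le_trans (Hk t t0) _.
rewrite ler_wpM2l// ler_expR ler_wpM2r// lerN2.
by rewrite /a0 (bigminD1 k)//= ge_min lexx.
Qed.

End ExponentialConvergence.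

(** * The Euclidean inner product and comparison of quadratic forms *)

Section EuclideanVectors.
Context {R : realType}.

Definition dot (n : nat) (u v : 'cV[R]_n) : R := \sum_k u k ord0 * v k ord0.

Lemma dotE n (u v : 'cV[R]_n) : dot u v = (u^T *m v) ord0 ord0.
Proof. by rewrite mxE; apply: eq_bigr => k _; rewrite mxE. Qed.

Lemma dotC n (u v : 'cV[R]_n) : dot u v = dot v u.
Proof. by apply: eq_bigr => k _; rewrite mulrC. Qed.

Lemma dotDl n (u v w : 'cV[R]_n) : dot (u + v) w = dot u w + dot v w.
Proof. by rewrite -big_split; apply: eq_bigr => k _; rewrite mxE mulrDl. Qed.

Lemma dotDr n (u v w : 'cV[R]_n) : dot w (u + v) = dot w u + dot w v.
Proof. by rewrite !(dotC w) dotDl. Qed.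

Lemma dotZl n (a : R) (u v : 'cV[R]_n) : dot (a *: u) v = a * dot u v.
Proof. by rewrite mulr_sumr; apply: eq_bigr => k _; rewrite mxE mulrA. Qed.

Lemma dotZr n (a : R) (u v : 'cV[R]_n) : dot u (a *: v) = a * dot u v.
Proof. by rewrite !(dotC u) dotZl. Qed.

Lemma dotNl n (u v : 'cV[R]_n) : dot (- u) v = - dot u v.
Proof. by rewrite -scaleN1r dotZl mulN1r. Qed.

Lemma dotNr n (u v : 'cV[R]_n) : dot u (- v) = - dot u v.
Proof. by rewrite !(dotC u) dotNl. Qed.

Lemma dot0l n (u : 'cV[R]_n) : dot 0 u = 0.
Proof. by rewrite -(scale0r 0) dotZl mul0r. Qed.

Lemma dot0r n (u : 'cV[R]_n) : dot u 0 = 0.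
Proof. by rewrite dotC dot0l. Qed.

Lemma dot_sumr n (I : finType) (P : pred I) (u : 'cV[R]_n) (v : I -> 'cV[R]_n) :
  dot u (\sum_(i | P i) v i) = \sum_(i | P i) dot u (v i).
Proof. by apply: (big_morph (dot u) _ (dot0r u)) => x y; exact: dotDr. Qed.

Lemma dot_mul m n (B : 'M[R]_(m, n)) (u : 'cV[R]_m) (v : 'cV[R]_n) :
  dot u (B *m v) = dot (B^T *m u) v.
Proof. by rewrite !dotE trmx_mul trmxK mulmxA. Qed.

Lemma dot_ge0 n (u : 'cV[R]_n) : 0 <= dot u u.
Proof. by apply: sumr_ge0 => k _; exact: sqr_ge0. Qed.

Lemma dot_eq0 n (u : 'cV[R]_n) : (dot u u == 0) = (u == 0).
Proof.
apply/eqP/eqP => [u0|->]; last exact: dot0l.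
apply/colP => k; rewrite mxE; apply/eqP.
have /psumr_eq0P H := u0; have := H (fun i _ => sqr_ge0 (u i ord0)) k isT.
by move/eqP; rewrite mulf_eq0 orbb.
Qed.

Lemma dot_ext n (u v : 'cV[R]_n) : (forall w, dot w u = dot w v) -> u = v.
Proof.
move=> H; apply/eqP; rewrite -subr_eq0 -dot_eq0 dotDr dotNr H.
by rewrite subrr.
Qed.

Lemma dot_col_mx m n (u u' : 'cV[R]_m) (v v' : 'cV[R]_n) :
  dot (col_mx u v) (col_mx u' v') = dot u u' + dot v v'.
Proof. by rewrite !dotE tr_col_mx mul_row_col mxE. Qed.

Lemma dot_mxcol p (q : 'I_p -> nat) (u v : forall i, 'cV[R]_(q i)) :
  dot (\mxcol_i u i) (\mxcol_i v i) = \sum_i dot (u i) (v i).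
Proof.
rewrite dotE tr_mxcol mul_mxrow_mxcol summxE.
by apply: eq_bigr => i _; rewrite dotE.
Qed.

(** The form is nonnegative at s u + t v; for s = - c and t = a its value is a (a b - c^2), which
    settles the case a > 0. *)
Lemma psd_CauchySchwarz n (Q : 'M[R]_n) (u v : 'cV[R]_n) : Q^T = Q ->
  (forall w, 0 <= dot w (Q *m w)) ->
  dot u (Q *m v) ^+ 2 <= dot u (Q *m u) * dot v (Q *m v).
Proof.
move=> QT Q0; set a := dot u (Q *m u); set b := dot v (Q *m v).
set c := dot u (Q *m v).
have vu : dot v (Q *m u) = c by rewrite dot_mul QT dotC.
have H s t : 0 <= s ^+ 2 * a + 2 * s * t * c + t ^+ 2 * b.
  have := Q0 (s *: u + t *: v).
  rewrite mulmxDr -!scalemxAr !(dotDl, dotDr, dotZl, dotZr) vu -/a -/b -/c.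
  by congr (0 <= _); ring.
have := Q0 u; rewrite -/a le_eqVlt => /predU1P[a0|a0].
  (* When a = 0, these coefficients give the value - 4 c^2, so c = 0. *)
  have := H (- (b + 1)) (2 * c); rewrite -a0; have := H 0 1; rewrite -a0.
  by have := sqr_ge0 c; nra.
have := H (- c) a; rewrite (_ : _ + _ = a * (a * b - c ^+ 2)); last by ring.
by rewrite pmulr_rge0// subr_ge0.
Qed.

Lemma dot_CauchySchwarz n (u v : 'cV[R]_n) : dot u v ^+ 2 <= dot u u * dot v v.
Proof.
have := @psd_CauchySchwarz n 1%:M u v; rewrite !mul1mx; apply.
  exact: trmx1.
by move=> w; rewrite mul1mx; exact: dot_ge0.
Qed.

(** Cauchy-Schwarz on each row bounds the operator by its Frobenius norm; adding 1 makes the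
    constant positive. *)
Lemma dot_mul_le m n (B : 'M[R]_(m, n)) : exists2 K : R, 0 < K &
  forall u, dot (B *m u) (B *m u) <= K * dot u u.
Proof.
pose K := \sum_i dot (row i B)^T (row i B)^T.
have K0 : 0 <= K by apply: sumr_ge0 => i _; exact: dot_ge0.
exists (K + 1); first by lra.
move=> u; apply: (@le_trans _ _ (K * dot u u)); last first.
  by have := dot_ge0 u; lra.
rewrite {1}/dot mulr_suml; apply: ler_sum => i _.
have -> : (B *m u) i ord0 = dot (row i B)^T u.
  by rewrite mxE; apply: eq_bigr => j _; rewrite !mxE.
by rewrite -expr2; exact: dot_CauchySchwarz.
Qed.

(** The columns of [cokermx A] lie in the kernel of A, hence in that of B, and B times [cokermx A] =
    0 means that the row space of B is contained in that of A. *)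
Lemma ker_sub_mul m n p (A : 'M[R]_(m, n)) (B : 'M[R]_(p, n)) :
  (forall u : 'cV_n, A *m u = 0 -> B *m u = 0) -> exists T, B = T *m A.
Proof.
move=> AB; suff /submxP : (B <= A)%MS by [].
rewrite submxE; apply/eqP/matrixP => i j; rewrite [RHS]mxE.
have := AB (col j (cokermx A)); rewrite !colE !(mulmxA _ (cokermx A)).
by rewrite mulmx_coker mul0mx -colE => /(_ erefl)/colP/(_ i); rewrite !mxE.
Qed.

Lemma ker_sub_le m n p (A : 'M[R]_(m, n)) (B : 'M[R]_(p, n)) :
  (forall u : 'cV_n, A *m u = 0 -> B *m u = 0) -> exists2 K : R, 0 < K &
  forall u, dot (B *m u) (B *m u) <= K * dot (A *m u) (A *m u).
Proof.
move=> /ker_sub_mul[T ->]; have [K K0 H] := dot_mul_le T.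
by exists K => // u; rewrite -mulmxA.
Qed.

(** For v = Q u, Cauchy-Schwarz for the form Q gives |v|^4 <= <v, Q v> <u, Q u>; bound <v, Q v> by a
    multiple of |v|^2 and divide by |v|^2. *)
Lemma psd_mul_le n (Q : 'M[R]_n) : Q^T = Q ->
  (forall w, 0 <= dot w (Q *m w)) -> exists2 K : R, 0 < K &
  forall u, dot (Q *m u) (Q *m u) <= K * dot u (Q *m u).
Proof.
move=> QT Q0; have [K K0 H] := dot_mul_le Q.
exists (1 + K); first by lra.
move=> u; set v := Q *m u.
have := psd_CauchySchwarz v u QT Q0; rewrite -/v.
have := dot_ge0 v; rewrite le_eqVlt => /predU1P[<- _|v0 H1].
  by rewrite mulr_ge0 ?Q0//; lra.
have vQv : dot v (Q *m v) <= (1 + K) * dot v v.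
  have := dot_ge0 (v - Q *m v); rewrite !(dotDl, dotDr, dotNl, dotNr).
  by rewrite (dotC (Q *m v) v); have := H v; have := v0; nra.
have := Q0 u; rewrite -/v => u0.
rewrite -(ler_pM2l v0); nra.
Qed.

(** The Fredholm alternative, read off from the factorization of f^T through B^T. *)
Lemma orth_ker_tr_range m n (B : 'M[R]_(m, n)) (f : 'cV[R]_m) :
  (forall k, B^T *m k = 0 -> dot f k = 0) -> exists u, f = B *m u.
Proof.
move=> H; have [T] : exists T, f^T = T *m B^T.
  apply: ker_sub_mul => k /H; rewrite dotE => fk.
  by apply/colP => i; rewrite ord1 fk mxE.
by move=> /(congr1 trmx); rewrite trmx_mul !trmxK => ->; exists T^T.
Qed.

End EuclideanVectors.

(** * Convergence and differentiation of vector-valued trajectories *)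

Section VectorTrajectories.
Context {R : realType}.

Lemma exp_cvgP (n : nat) (f : R -> 'cV[R]_n) (l : 'cV[R]_n) :
  exp_cvg f l <-> forall k, exp_cvg1 (fun t => f t k ord0) (l k ord0).
Proof.
split=> [[C [a [C0 a0 H]]] k|]; last exact: exp_cvg_coord.
exists C, a; split=> // t t0; apply: le_trans (H t t0).
rewrite -sqrtr_sqr ler_wsqrtr// (bigD1 k)//= !mxE lerDl.
by apply: sumr_ge0 => i _; exact: sqr_ge0.
Qed.

Lemma eq_exp_cvg n (f g : R -> 'cV[R]_n) l : (forall t, 0 <= t -> f t = g t) ->
  exp_cvg f l -> exp_cvg g l.
Proof.
move=> fg /exp_cvgP fl; apply/exp_cvgP => k.
by apply: eq_exp_cvg1 (fl k) => t t0; rewrite fg.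
Qed.

Lemma exp_cvg_cst n (l : 'cV[R]_n) : exp_cvg (fun=> l) l.
Proof. by apply/exp_cvgP => k; exact: exp_cvg1_cst. Qed.

Lemma exp_cvgD n (f g : R -> 'cV[R]_n) l l' : exp_cvg f l -> exp_cvg g l' ->
  exp_cvg (fun t => f t + g t) (l + l').
Proof.
move=> /exp_cvgP fl /exp_cvgP gl'; apply/exp_cvgP => k; rewrite mxE.
by apply: eq_exp_cvg1 (exp_cvg1D (fl k) (gl' k)) => t _; rewrite mxE.
Qed.

Lemma exp_cvg_mul m n (B : 'M[R]_(m, n)) (f : R -> 'cV[R]_n) l :
  exp_cvg f l -> exp_cvg (fun t => B *m f t) (B *m l).
Proof.
move=> /exp_cvgP fl; apply/exp_cvgP => k; rewrite mxE.
apply: (@eq_exp_cvg1 _ (fun t => \sum_j B k j * f t j ord0)).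
  by move=> t _; rewrite mxE.
by apply: exp_cvg1_sum => j _; exact: exp_cvg1Z.
Qed.

Lemma exp_cvgZ n (a : R) (f : R -> 'cV[R]_n) l :
  exp_cvg f l -> exp_cvg (fun t => a *: f t) (a *: l).
Proof.
move=> /(exp_cvg_mul a%:M); rewrite mul_scalar_mx.
by apply: eq_exp_cvg => t _; rewrite mul_scalar_mx.
Qed.

Lemma exp_cvg_unique n (f : R -> 'cV[R]_n) l l' :
  exp_cvg f l -> exp_cvg f l' -> l = l'.
Proof.
move=> /exp_cvgP fl /exp_cvgP fl'.
by apply/colP => k; exact: exp_cvg1_unique (fl k) (fl' k).
Qed.

Lemma is_deriv_ge0_cst n (t : R) (a : 'cV[R]_n) : is_deriv_ge0 (fun=> a) t 0.
Proof. by apply/is_deriv_ge0P => k; rewrite mxE; exact: deriv_ge0_cst. Qed.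

Lemma is_deriv_ge0D n (f g : R -> 'cV[R]_n) t u v :
  is_deriv_ge0 f t u -> is_deriv_ge0 g t v ->
  is_deriv_ge0 (fun s => f s + g s) t (u + v).
Proof.
move=> /is_deriv_ge0P fu /is_deriv_ge0P gv; apply/is_deriv_ge0P => k.
rewrite mxE (_ : (fun s => _) = fun s => f s k ord0 + g s k ord0).
  exact: deriv_ge0D.
by apply/funext => s; rewrite mxE.
Qed.

Lemma is_deriv_ge0_mul m n (B : 'M[R]_(m, n)) (f : R -> 'cV[R]_n) t v :
  is_deriv_ge0 f t v -> is_deriv_ge0 (fun s => B *m f s) t (B *m v).
Proof.
move=> /is_deriv_ge0P fv; apply/is_deriv_ge0P => k.
rewrite mxE (_ : (fun s => _) = fun s => \sum_j B k j * f s j ord0).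
  by apply: deriv_ge0_sum => j _; exact: deriv_ge0Z.
by apply/funext => s; rewrite mxE.
Qed.

Lemma is_deriv_ge0Z n (a : R) (f : R -> 'cV[R]_n) t v :
  is_deriv_ge0 f t v -> is_deriv_ge0 (fun s => a *: f s) t (a *: v).
Proof.
move=> /(is_deriv_ge0_mul (B := a%:M)); rewrite mul_scalar_mx.
by congr is_deriv_ge0; apply/funext => s; rewrite mul_scalar_mx.
Qed.

Lemma is_deriv_ge0_col_mx m n (f : R -> 'cV[R]_m) (g : R -> 'cV[R]_n) t u v :
  is_deriv_ge0 f t u -> is_deriv_ge0 g t v ->
  is_deriv_ge0 (fun s => col_mx (f s) (g s)) t (col_mx u v).
Proof.
move=> /is_deriv_ge0P fu /is_deriv_ge0P gv; apply/is_deriv_ge0P => k.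
case: (split_ordP k) => j ->.
  rewrite col_mxEu (_ : (fun s => _) = fun s => f s j ord0) //.
  by apply/funext => s; rewrite col_mxEu.
rewrite col_mxEd (_ : (fun s => _) = fun s => g s j ord0) //.
by apply/funext => s; rewrite col_mxEd.
Qed.

Lemma is_deriv_ge0_mxcol p (q : 'I_p -> nat) (f : forall i, R -> 'cV[R]_(q i))
    t (v : forall i, 'cV[R]_(q i)) : (forall i, is_deriv_ge0 (f i) t (v i)) ->
  is_deriv_ge0 (fun s => \mxcol_i f i s) t (\mxcol_i v i).
Proof.
move=> fv; apply/is_deriv_ge0P => k; rewrite mxE.
rewrite (_ : (fun s => _) = fun s => f (tagnat.sig1 k) s (tagnat.sig2 k) ord0).
  by have /is_deriv_ge0P := fv (tagnat.sig1 k); exact.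
by apply/funext => s; rewrite mxE.
Qed.

Lemma deriv_ge0_dot n (f g : R -> 'cV[R]_n) t u v :
  is_deriv_ge0 f t u -> is_deriv_ge0 g t v ->
  deriv_ge0 (fun s => dot (f s) (g s)) t (dot u (g t) + dot (f t) v).
Proof.
move=> /is_deriv_ge0P fu /is_deriv_ge0P gv; rewrite /dot -big_split /=.
by apply: deriv_ge0_sum => k _; exact: deriv_ge0M.
Qed.

(** The squared norm is nonincreasing and starts at 0. *)
Lemma is_deriv_ge0_eq0 n (f : R -> 'cV[R]_n) :
  (forall t, 0 <= t -> is_deriv_ge0 f t 0) -> f 0 = 0 ->
  forall t, 0 <= t -> f t = 0.
Proof.
move=> fd f0 t t0; apply/eqP; rewrite -dot_eq0 eq_le dot_ge0 andbT.
rewrite [leRHS](_ : 0 = dot (f 0) (f 0)); last by rewrite f0 dot0l.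
apply: (deriv_ge0_nincr (fun t t0 => deriv_ge0_dot (fd t t0) (fd t t0))) => // s _.
by rewrite dot0l dot0r addr0.
Qed.

End VectorTrajectories.

(** * Affine systems with a dissipative matrix *)

Section DissipativeSystem.
Context {R : realType} {n : nat}.
Variable M : 'M[R]_n.
Hypothesis dissM : forall u, dot u (M *m u) <= 0.
(** An observability condition: under [dissM], <u, M u> = 0 is equivalent to (M + M^T) u = 0, so a
    vector whose dissipation vanishes together with that of its velocity must be an equilibrium. *)
Hypothesis obsM : forall u, dot u (M *m u) = 0 ->
  dot (M *m u) (M *m (M *m u)) = 0 -> M *m u = 0.

Let diss2 (k u : 'cV[R]_n) (s : R) :
  s ^+ 2 * dot k (M *m k) + s * (dot k (M *m u) + dot u (M *m k)) +
    dot u (M *m u) <= 0.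
Proof.
have := dissM (s *: k + u).
rewrite mulmxDr -scalemxAr !(dotDl, dotDr, dotZl, dotZr).
by congr (_ <= 0); ring.
Qed.

Let slope_eq0 (a c : R) : (forall s, s * a + c <= 0) -> a = 0.
Proof.
move=> H; apply/eqP/negPn/negP => a0.
by have := H ((1 - c) / a); rewrite mulfVK//; lra.
Qed.

(** Along s (M u) + u the form is affine in s with slope |M u|^2, and it is bounded above. *)
Lemma dissipative_ker2 (u : 'cV[R]_n) : M *m (M *m u) = 0 -> M *m u = 0.
Proof.
move=> MMu; apply/eqP; rewrite -dot_eq0; apply/eqP.
apply: (@slope_eq0 _ (dot u (M *m u))) => s.
by have := diss2 (M *m u) u s; rewrite MMu !dot0r mulr0 add0r addr0.
Qed.

(** As k is orthogonal to the range of M, the form along s k + M k is affine in s with slope |M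
    k|^2. *)
Lemma dissipative_ker_tr (k : 'cV[R]_n) : M^T *m k = 0 -> M *m k = 0.
Proof.
move=> Mk; have k0 u : dot k (M *m u) = 0 by rewrite dot_mul Mk dot0l.
apply/eqP; rewrite -dot_eq0; apply/eqP.
apply: (@slope_eq0 _ (dot (M *m k) (M *m (M *m k)))) => s.
by have := diss2 k (M *m k) s; rewrite !k0 mulr0 !add0r.
Qed.

(** With F = 1 - e Q Q M, the derivative of <u, F u> along u' = M u is - <u, Q u> - e |Q M u|^2 - e
    <Q u, Q M M u>. The first two terms control |Q u|^2 and |Q M u|^2, hence |M u|^2 by [obsM], and
    they absorb the last one when e is small. *)
Lemma dissipative_strict_lyapunov : exists (F : 'M[R]_n) (d : R), [/\ 0 < d,
  forall u, dot u u <= 2 * dot u (F *m u),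
  forall u, dot u (F *m u) <= 2 * dot u u &
  forall u, dot (M *m u) (F *m u) + dot u (F *m (M *m u)) <=
            - d * dot (M *m u) (M *m u)].
Proof.
pose Q := - (M + M^T).
have QT : Q^T = Q by rewrite /Q linearN linearD /= trmxK addrC.
have dQ u : dot u (Q *m u) = - 2 * dot u (M *m u).
  rewrite /Q mulNmx mulmxDl dotNr dotDr (dot_mul M^T u) trmxK (dotC (M *m u)).
  by ring.
have Q0 u : 0 <= dot u (Q *m u) by rewrite dQ; have := dissM u; lra.
have [K1 K1_gt0 HK1] := psd_mul_le QT Q0.
have [K2 K2_gt0 HK2] := dot_mul_le (Q *m M).
(* By [obsM], the common kernel of Q and Q M lies in the kernel of M. *)
have [K3 K3_gt0 HK3] : exists2 K : R, 0 < K & forall u,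
    dot (M *m u) (M *m u) <= K * (dot (Q *m u) (Q *m u) +
      dot (Q *m (M *m u)) (Q *m (M *m u))).
  have [u|K K0 H] := @ker_sub_le _ _ _ _ (col_mx Q (Q *m M)) M.
    rewrite mul_col_mx -mulmxA -col_mx0 => /eq_col_mx[Qu QMu].
    apply: obsM.
      by have := dQ u; rewrite Qu dot0r; lra.
    by have := dQ (M *m u); rewrite QMu dot0r; lra.
  exists K => // u; have := H u.
  by rewrite mul_col_mx -mulmxA dot_col_mx.
have [K4 K4_gt0 HK4] := dot_mul_le (Q *m (Q *m M)).
pose k := K2 * K3; have k0 : 0 < k by rewrite mulr_gt0.
(* One small [e] for two purposes: e (k + 1) K1 <= 1 lets <u, Q u> absorb the terms in |Q u|^2, and
   e (1 + K4) <= 1 keeps <u, F u> between |u|^2 / 2 and 2 |u|^2. *)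
pose e := ((k + 1) * K1 + 1 + K4)^-1.
have e0 : 0 < e by rewrite invr_gt0 !addr_gt0// mulr_gt0// addr_gt0.
have eE : e * ((k + 1) * K1 + 1 + K4) = 1.
  by rewrite mulVf//; rewrite -invr_eq0 gt_eqF.
have ekK : e * ((k + 1) * K1) <= 1.
  by have := mulr_gt0 e0 K4_gt0; lra.
have eK4 : e * (1 + K4) <= 1.
  by have := mulr_gt0 e0 (mulr_gt0 (addr_gt0 k0 ltr01) K1_gt0); lra.
have eK1 : e * K1 <= 1.
  by have := mulr_gt0 e0 (mulr_gt0 k0 K1_gt0); lra.
exists (1%:M - e *: (Q *m (Q *m M))), (e / 2 / K3); split.
- by rewrite !divr_gt0.
- move=> u; rewrite mulmxBl mul1mx -scalemxAl dotDr dotNr dotZr.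
  have := dot_ge0 (u - Q *m (Q *m M) *m u).
  rewrite !(dotDl, dotDr, dotNl, dotNr) (dotC _ u).
  set z := dot u (_ *m u); have := HK4 u; have := dot_ge0 u.
  set a := dot u u; set b := dot _ _ => a0 ba ab.
  have z1 : 2 * z <= (1 + K4) * a by lra.
  have := ler_wpM2l (ltW e0) z1; have := ler_wpM2r a0 eK4; lra.
- move=> u; rewrite mulmxBl mul1mx -scalemxAl dotDr dotNr dotZr.
  have := dot_ge0 (u + Q *m (Q *m M) *m u).
  rewrite !(dotDl, dotDr) (dotC _ u).
  set z := dot u (_ *m u); have := HK4 u; have := dot_ge0 u.
  set a := dot u u; set b := dot _ _ => a0 ba ab.
  have z1 : - 2 * z <= (1 + K4) * a by lra.
  have := ler_wpM2l (ltW e0) z1; have := ler_wpM2r a0 eK4; lra.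
move=> u; set F := 1%:M - _.
have -> : dot (M *m u) (F *m u) + dot u (F *m (M *m u)) =
    2 * dot u (M *m u) - e * (dot (Q *m (M *m u)) (Q *m (M *m u)) +
      dot (Q *m u) (Q *m (M *m (M *m u)))).
  rewrite /F !mulmxBl !mul1mx -!scalemxAl !(dotDr, dotNr, dotZr) -!mulmxA.
  by rewrite (dot_mul Q (M *m u)) (dot_mul Q u) QT (dotC (M *m u) u); ring.
have := HK3 u; have := dQ u; have := HK1 u; have := HK2 (M *m u).
rewrite -!mulmxA.
set v := Q *m (M *m (M *m u)).
have := dot_ge0 (k *: (Q *m u) + v).
rewrite !(dotDl, dotDr, dotZl, dotZr) (dotC v).
set q := dot (Q *m u) (Q *m u); set z := dot (Q *m u) v.
set p := dot (Q *m (M *m u)) (Q *m (M *m u)).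
set m := dot (M *m u) (M *m u); set w := dot v v.
set a := dot u (M *m u); set d := dot u (Q *m u) => H1 H2 H3 H4 H5.
have q0 : 0 <= q by exact: dot_ge0.
have p0 : 0 <= p by exact: dot_ge0.
(* Young's inequality with weight k, from |k Q u + v|^2 >= 0 and |v|^2 <= k (q + p). *)
have z1 : - (2 * z) <= k * q + q + p.
  rewrite -(ler_pM2l k0).
  have : K2 * m <= k * (q + p) by rewrite /k -mulrA ler_pM2l.
  by move: H1 H2; lra.
have z2 : e * - (2 * z) <= e * (k * q + q + p) by rewrite ler_pM2l.
have q1 : e * (k + 1) * q <= d.
  have : e * (k + 1) * q <= e * (k + 1) * (K1 * d).
    by rewrite ler_pM2l// mulr_gt0// addr_gt0.
  have : e * ((k + 1) * K1) * d <= 1 * d by apply: ler_wpM2r => //; exact: Q0.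
  lra.
have q2 : e * q <= d.
  have : e * q <= e * (K1 * d) by rewrite ler_pM2l.
  have : e * K1 * d <= 1 * d by apply: ler_wpM2r => //; exact: Q0.
  lra.
(* Half of [d] and half of [e * p] are left over, and together they dominate a multiple of |M
   u|^2. *)
have m1 : e / 2 / K3 * m <= e / 2 * (q + p).
  have -> : e / 2 * (q + p) = e / 2 / K3 * (K3 * (q + p)) by field; rewrite gt_eqF.
  by rewrite ler_pM2l ?divr_gt0.
lra.
Qed.

(** Once the velocity decays exponentially, each coordinate of s has a limit, and comparing the
    limits of M s + f shows that it is an equilibrium. *)
Theorem dissipative_exp_cvg (f : 'cV[R]_n) (s : R -> 'cV[R]_n) :
    (forall k, M *m k = 0 -> dot f k = 0) ->
    (forall t, 0 <= t -> is_deriv_ge0 s t (M *m s t + f)) ->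
  exists2 l, M *m l + f = 0 & exp_cvg s l.
Proof.
move=> fM ds.
have [u0 fE] : exists u, f = M *m u.
  by apply: orth_ker_tr_range => k /dissipative_ker_tr; exact: fM.
pose r t := M *m s t + f.
have dr t : 0 <= t -> is_deriv_ge0 r t (M *m r t).
  move=> t0; rewrite -[M *m r t]addr0; apply: is_deriv_ge0D; last exact: is_deriv_ge0_cst.
  exact/is_deriv_ge0_mul/ds.
(* As ker M^2 = ker M, |M v|^2 is at most a multiple of |M M v|^2; for v = s t + u0 this bounds
   |r|^2 by |M r|^2. *)
have [u|K K0 HK] := @ker_sub_le _ _ _ _ (M *m M) M.
  by rewrite -mulmxA; exact: dissipative_ker2.
have {}HK t : dot (r t) (r t) <= K * dot (M *m r t) (M *m r t).
  have -> : r t = M *m (s t + u0) by rewrite /r fE mulmxDr.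
  by have := HK (s t + u0); rewrite -mulmxA.
have [F [d [d0 F1 F2 F3]]] := dissipative_strict_lyapunov.
pose W t := dot (r t) (F *m r t).
(* The rate comes from <r, F r> <= 2 |r|^2 <= 2 K |M r|^2. *)
pose a := d / (2 * K); have a0 : 0 < a by rewrite divr_gt0// mulr_gt0.
have W_decay t : 0 <= t -> W t <= W 0 * expR (- a * t).
  apply: (@deriv_ge0_decay _ _ (fun t => dot (M *m r t) (F *m r t) +
    dot (r t) (F *m (M *m r t)))) => t' t'0.
    exact: deriv_ge0_dot (dr t' t'0) (is_deriv_ge0_mul (dr t' t'0)).
  apply: le_trans (F3 (r t')) _; rewrite !mulNr lerN2.
  have := HK t'; have := F2 (r t'); rewrite -/(W t').
  move=> h1 h2; have h3 : W t' <= 2 * K * dot (M *m r t') (M *m r t') by lra.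
  rewrite /a mulrAC ler_pdivrMr ?mulr_gt0// -mulrA ler_pM2l//; lra.
have r0 : exp_cvg r 0.
  apply/exp_cvgP => k; rewrite mxE; apply: (exp_cvg1_sqr (C := 2 * W 0) a0) => t t0.
  apply: (@le_trans _ _ (dot (r t) (r t))).
    rewrite /dot (bigD1 k)//= expr2 lerDl.
    by apply: sumr_ge0 => i _; rewrite -expr2 sqr_ge0.
  by apply: le_trans (F1 _) _; rewrite -mulrA ler_pM2l// W_decay.
have /choice[l sl] : forall k, exists l, exp_cvg1 (fun t => s t k ord0) l.
  move=> k; apply: (@exp_cvg1_deriv _ _ (fun t => r t k ord0)).
    by move=> t t0; have /is_deriv_ge0P := ds t t0; exact.
  by have /exp_cvgP/(_ k) := r0; rewrite mxE.
have sl' : exp_cvg s (\col_k l k) by apply/exp_cvgP => k; rewrite mxE.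
exists (\col_k l k) => //.
exact: exp_cvg_unique (exp_cvgD (exp_cvg_mul M sl') (exp_cvg_cst f)) r0.
Qed.

End DissipativeSystem.

(** For linear identities between matrices: products are generalized to opaque atoms, and [ring]
    closes the goal entrywise. *)
Ltac lincomb :=
  repeat match goal with |- context [@mulmx _ ?m ?n ?p ?A ?B] =>
    let u := fresh "u" in set u := (@mulmx _ m n p A B); clearbody u end;
  apply/matrixP => ? ?; rewrite !mxE; ring.

(** * Exponential convergence of blocks *)

Section Blocks.
Context {R : realType}.

Lemma exp_cvg_usubmx m n (f : R -> 'cV[R]_(m + n)) l :
  exp_cvg f l -> exp_cvg (fun t => usubmx (f t)) (usubmx l).
Proof.
move=> /exp_cvgP fl; apply/exp_cvgP => k; rewrite mxE.
by apply: eq_exp_cvg1 (fl (lshift n k)) => t _; rewrite mxE.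
Qed.

Lemma exp_cvg_dsubmx m n (f : R -> 'cV[R]_(m + n)) l :
  exp_cvg f l -> exp_cvg (fun t => dsubmx (f t)) (dsubmx l).
Proof.
move=> /exp_cvgP fl; apply/exp_cvgP => k; rewrite mxE.
by apply: eq_exp_cvg1 (fl (rshift m k)) => t _; rewrite mxE.
Qed.

Lemma exp_cvg_submxcol p (q : 'I_p -> nat) (f : R -> 'cV[R]_(\sum_i q i)) l i :
  exp_cvg f l -> exp_cvg (fun t => submxcol (f t) i) (submxcol l i).
Proof.
move=> /exp_cvgP fl; apply/exp_cvgP => k; rewrite mxE.
by apply: eq_exp_cvg1 (fl (tagnat.Rank i k)) => t _; rewrite mxE.
Qed.

End Blocks.

(** * The stacked primal-dual system *)

Section PrimalDual.
Context {R : realType} {p q e h : nat}.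
Variables (D : 'M[R]_(q, p)) (G : 'M[R]_(e, q)) (H : 'M[R]_(h, p)) (beta : 'cV[R]_q).

Let L := H^T *m H.

(** With w = x + z, the equation of x becomes x' = - D^T y + L w - 2 L x, and in w' = - L x all
    other terms cancel. The coupling of x and w is thus skew, and the remaining blocks form a
    negative semidefinite matrix. *)
Let M : 'M[R]_(p + (e + p)) :=
  block_mx (- (D^T *m D) - 2 *: L) (row_mx (D^T *m G^T) L)
           (col_mx (G *m D) (- L)) (block_mx (- (G *m G^T)) 0 0 0).

Let ME (x : 'cV[R]_p) (eta : 'cV[R]_e) (w : 'cV[R]_p) :
  M *m col_mx x (col_mx eta w) =
  col_mx (- (D^T *m (D *m x - G^T *m eta)) + L *m w - 2 *: (L *m x))
    (col_mx (G *m (D *m x - G^T *m eta)) (- (L *m x))).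
Proof.
rewrite mul_block_col mul_row_col mul_col_mx mul_block_col add_col_mx.
rewrite !mul0mx !addr0 !mulmxBr !mulmxBl !mulNmx -scalemxAl -!mulmxA.
congr col_mx; lincomb.
Qed.

Let dotM (x : 'cV[R]_p) (eta : 'cV[R]_e) (w : 'cV[R]_p) :
  let u := col_mx x (col_mx eta w) in let y := D *m x - G^T *m eta in
  dot u (M *m u) = - (dot y y + 2 * dot (H *m x) (H *m x)).
Proof.
move=> u y; rewrite ME -/y.
have : dot y y = dot (D *m x) y - dot (G^T *m eta) y.
  by rewrite -dotNl -dotDl.
clearbody y => ->; rewrite !dot_col_mx !(dotDr, dotNr, dotZr) /L -!mulmxA.
by rewrite (dot_mul D^T) (dot_mul G) !(dot_mul H^T) !trmxK (dotC (H *m w)); ring.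
Qed.

Let M_diss u : dot u (M *m u) <= 0.
Proof.
rewrite -(vsubmxK u) -(vsubmxK (dsubmx u)) dotM oppr_le0.
by rewrite addr_ge0 ?mulr_ge0 ?dot_ge0.
Qed.

Let M_ker x eta w : let u := col_mx x (col_mx eta w) in
  dot u (M *m u) = 0 -> D *m x - G^T *m eta = 0 /\ H *m x = 0.
Proof.
rewrite /= dotM => /eqP; rewrite oppr_eq0 paddr_eq0 ?mulr_ge0 ?dot_ge0//.
by rewrite mulf_eq0 !dot_eq0 pnatr_eq0 => /andP[/eqP-> /eqP->].
Qed.

(** Vanishing dissipation at u leaves M u = (L w, 0, 0); vanishing dissipation there gives H L w =
    0, whence |L w|^2 = <H w, H L w> = 0. *)
Let M_obs u : dot u (M *m u) = 0 -> dot (M *m u) (M *m (M *m u)) = 0 ->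
  M *m u = 0.
Proof.
rewrite -(vsubmxK u) -(vsubmxK (dsubmx u)).
set x := usubmx u; set eta := usubmx _; set w := dsubmx _.
move=> /M_ker[y0 Hx0].
have Lx0 : L *m x = 0 by rewrite /L -mulmxA Hx0 mulmx0.
rewrite ME y0 Lx0 !mulmx0 oppr0 scaler0 add0r subr0 => /M_ker[_ HLw].
suff -> : L *m w = 0 by rewrite !col_mx0.
apply/eqP; rewrite -dot_eq0 [X in dot _ X](_ : _ = H^T *m (H *m w)).
  by rewrite dot_mul trmxK HLw dot0l.
by rewrite mulmxA.
Qed.

(** The last two conclusions are kept in a form suited to summation over blocks: the terms H^T zs
    and G^T eta vanish when summed over clusters and over agents. *)
Theorem primal_dual_exp_cvg (X Z : R -> 'cV[R]_p) (Xi Y : R -> 'cV[R]_q) :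
    (forall t, 0 <= t -> is_deriv_ge0 X t
       (- (D^T *m Y t - H^T *m (H *m Z t)) - H^T *m (H *m X t))) ->
    (forall t, 0 <= t -> is_deriv_ge0 Xi t (- (G^T *m (G *m Y t)))) ->
    (forall t, 0 <= t -> Y t = Xi t + D *m X t - beta) ->
    (forall t, 0 <= t -> is_deriv_ge0 Z t (D^T *m Y t - H^T *m (H *m Z t))) ->
    Xi 0 = 0 ->
  exists xs ys zs eta, [/\ exp_cvg X xs /\ exp_cvg Y ys, H *m xs = 0, G *m ys = 0,
    D^T *m ys = H^T *m zs & ys = D *m xs - beta - G^T *m eta].
Proof.
move=> dX dXi YE dZ Xi0.
have [T GT] : exists T, G = T *m (G^T *m G).
  apply: ker_sub_mul => u Gu; apply/eqP; rewrite -dot_eq0.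
  by rewrite dot_mul mulmxA Gu dot0l.
(* Since T G^T G = G, this linear image of Xi satisfies eta' = G Y, so no integral is taken. *)
pose eta t := - (T *m Xi t).
have XiE t : 0 <= t -> Xi t = - (G^T *m eta t).
  move=> t0; rewrite /eta mulmxN opprK mulmxA; apply/eqP; rewrite eq_sym -subr_eq0.
  rewrite -[X in _ - X]mul1mx -mulmxBl; apply/eqP.
  (* G^T T fixes the range of G^T G, so the derivative is 0; the initial condition on Xi starts the
     function at 0. *)
  apply: (is_deriv_ge0_eq0 (f := fun t => (G^T *m T - 1%:M) *m Xi t)) t0 => [s s0|].
    have := is_deriv_ge0_mul (B := G^T *m T - 1%:M) (dXi s s0).
    rewrite mulmxN mulmxBl mul1mx (mulmxA G^T G) -(mulmxA G^T T).
    by rewrite (mulmxA T) -GT (mulmxA G^T G) subrr oppr0.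
  by rewrite Xi0 mulmx0.
have YE' t : 0 <= t -> Y t = D *m X t - G^T *m eta t - beta.
  by move=> t0; rewrite YE// XiE// (addrC (- _)).
pose f : 'cV[R]_(p + (e + p)) := col_mx (D^T *m beta) (col_mx (- (G *m beta)) 0).
pose S t := col_mx (X t) (col_mx (eta t) (X t + Z t)).
have dS t : 0 <= t -> is_deriv_ge0 S t (M *m S t + f).
  move=> t0; have yE : D *m X t - G^T *m eta t = Y t + beta.
    by rewrite YE'// subrK.
  rewrite /S ME /f !add_col_mx addr0 yE !mulmxDr addrK.
  apply: is_deriv_ge0_col_mx; [|apply: is_deriv_ge0_col_mx].
  - rewrite (_ : _ + D^T *m beta =
      - (D^T *m Y t - H^T *m (H *m Z t)) - H^T *m (H *m X t)); first exact: dX.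
    by rewrite /L -!mulmxA; lincomb.
  - have := is_deriv_ge0_mul (B := - T) (dXi t t0).
    rewrite mulmxN mulNmx opprK (mulmxA G^T) mulmxA -GT.
    by congr is_deriv_ge0; apply/funext => s; rewrite mulNmx.
  - have := is_deriv_ge0D (dX t t0) (dZ t t0).
    by congr is_deriv_ge0; rewrite /L -!mulmxA; lincomb.
(* For k = (x, eta, w), <f, k> = <beta, D x - G^T eta>, and the second factor vanishes on ker M. *)
have fM k : M *m k = 0 -> dot f k = 0.
  move=> Mk; have := dot0r k; rewrite -Mk.
  rewrite -(vsubmxK k) -(vsubmxK (dsubmx k)) => /M_ker[y0 _].
  rewrite !dot_col_mx dot0l addr0 dotNl.
  rewrite -dot_mul (dotC (G *m _)) (dot_mul G) (dotC _ beta) -dotNr -dotDr y0.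
  by rewrite dot0r.
have [l Ml Sl] := dissipative_exp_cvg M_diss M_obs fM dS.
pose xs := usubmx l; pose es := usubmx (dsubmx l); pose ws := dsubmx (dsubmx l).
have lE : l = col_mx xs (col_mx es ws) by rewrite !vsubmxK.
have Xxs : exp_cvg X xs.
  by rewrite /xs; apply: eq_exp_cvg (exp_cvg_usubmx Sl) => t _; rewrite col_mxKu.
have Ees : exp_cvg eta es.
  apply: eq_exp_cvg (exp_cvg_usubmx (exp_cvg_dsubmx Sl)) => t _.
  by rewrite col_mxKd col_mxKu.
clearbody xs es ws; move: Ml; rewrite lE ME /f !add_col_mx => /eqP; rewrite !col_mx_eq0.
move=> /and3P[/eqP Mx /eqP My /eqP Mw].
pose y := D *m xs - G^T *m es.
(* [ws - xs] is the limit of Z; the third witness is its image under H. *)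
exists xs, (y - beta), (H *m (ws - xs)), es; split.
- split=> //.
  have := exp_cvgD (exp_cvgD (exp_cvg_mul D Xxs) (exp_cvg_mul (- G^T) Ees))
    (exp_cvg_cst (- beta)).
  rewrite mulNmx; apply: eq_exp_cvg => t t0.
  by rewrite YE'// mulNmx.
- move/eqP: Mw; rewrite addr0 oppr_eq0 => /eqP.
  rewrite /L -mulmxA => Lx; apply/eqP; rewrite -dot_eq0.
  by have := dot_mul H^T xs (H *m xs); rewrite Lx dot0r trmxK => <-.
- by rewrite mulmxBr.
- move/eqP: Mw; rewrite addr0 oppr_eq0 => /eqP Lx.
  move: Mx; rewrite Lx scaler0 subr0 -/y => /(canRL (addrK _)).
  rewrite sub0r => /(canRL (addKr _)); rewrite opprK => LE.
  by rewrite mulmxBr (mulmxA H^T) -/L (mulmxBr L) Lx subr0 LE; lincomb.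
- by rewrite /y addrAC.
Qed.

End PrimalDual.

(** * Block diagonal operators, incidence matrices and consensus *)

Section BlockOperators.
Context {R : realType}.

(** A block of rows of the identity acts as the selector of that block. *)
Lemma submxcol1_mul p (q : 'I_p -> nat) (V : forall i, 'cV[R]_(q i)) i :
  submxcol 1%:M i *m (\mxcol_i V i) = V i.
Proof. by rewrite submxcol_mul mul1mx mxcolK. Qed.

Lemma dot_mxcol_const p d (v : 'cV[R]_d) (w : 'cV[R]_(\sum_(i < p) d)) :
  dot (\mxcol_(i < p) v) w = dot v (\sum_i submxcol w i).
Proof. by rewrite -{1}[w]submxcolK dot_mxcol dot_sumr. Qed.

Definition blockdiag p (r q : 'I_p -> nat) (B : forall i, 'M[R]_(r i, q i)) :
    'M[R]_(\sum_i r i, \sum_i q i) :=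
  \mxcol_i (B i *m submxcol 1%:M i).

Lemma blockdiag_mul p (r q : 'I_p -> nat) (B : forall i, 'M[R]_(r i, q i))
    (V : forall i, 'cV[R]_(q i)) :
  blockdiag B *m \mxcol_i V i = \mxcol_i (B i *m V i).
Proof.
by rewrite mxcol_mul; apply: eq_mxcol => i; rewrite -mulmxA submxcol1_mul.
Qed.

Lemma blockdiag_tr_mul p (r q : 'I_p -> nat) (B : forall i, 'M[R]_(r i, q i))
    (V : forall i, 'cV[R]_(r i)) :
  (blockdiag B)^T *m \mxcol_i V i = \mxcol_i ((B i)^T *m V i).
Proof.
apply: dot_ext => w; rewrite -[w]submxcolK dot_mul trmxK blockdiag_mul !dot_mxcol.
by apply: eq_bigr => i _; rewrite dot_mul trmxK.
Qed.

(* One block row per ordered pair of vertices, so that every edge occurs twice: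
   hence the factor 1/2 under the root. *)
Definition incidence (n : nat) (e : rel 'I_n) (d : nat) :
    'M[R]_(\sum_(j < n) \sum_(k < n) d, \sum_(l < n) d) :=
  \mxcol_j \mxcol_k (Num.sqrt ((e j k)%:R / 2) *:
    (submxcol (p_ := fun=> d) 1%:M j - submxcol (p_ := fun=> d) 1%:M k)).

Lemma incidence_mul n (e : rel 'I_n) d (V : 'I_n -> 'cV[R]_d) :
  incidence e d *m \mxcol_j V j =
  \mxcol_j \mxcol_k (Num.sqrt ((e j k)%:R / 2) *: (V j - V k)).
Proof.
rewrite mxcol_mul; apply: eq_mxcol => j; rewrite mxcol_mul; apply: eq_mxcol => k.
by rewrite -scalemxAl mulmxBl !submxcol1_mul.
Qed.

(** Both sides are tested against an arbitrary vector, which turns the identity into one between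
    bilinear forms. *)
Lemma incidence_laplacian n (e : rel 'I_n) d (V : 'I_n -> 'cV[R]_d) :
  symmetric e ->
  (incidence e d)^T *m (incidence e d *m \mxcol_j V j) =
  \mxcol_j \sum_(k | e j k) (V j - V k).
Proof.
move=> e_sym; apply: dot_ext => w; rewrite dot_mul trmxK -[w]submxcolK.
set U := submxcol w; rewrite !incidence_mul !dot_mxcol.
pose a j k := (e j k)%:R * dot (U j) (V j - V k).
transitivity (\sum_j \sum_k a j k); last first.
  apply: eq_bigr => j _; rewrite dot_sumr [RHS]big_mkcond.
  by apply: eq_bigr => k _; rewrite /a; case: (e j k); rewrite ?mul1r ?mul0r.
(* By symmetry of e, the product of the two differences across an ordered pair splits into the
   contributions of its two ends. *)
transitivity (\sum_j \sum_k (a j k / 2 + a k j / 2)).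
  apply: eq_bigr => j _; rewrite dot_mxcol; apply: eq_bigr => k _.
  rewrite dotZl dotZr mulrA -expr2 sqr_sqrtr ?divr_ge0// /a (e_sym k j).
  by rewrite !(dotDl, dotDr, dotNl, dotNr); field.
under eq_bigr do rewrite big_split; rewrite big_split /= [X in _ + X]exchange_big.
rewrite -big_split; apply: eq_bigr => j _; rewrite -big_split.
by apply: eq_bigr => k _ /=; field.
Qed.

Lemma incidence_const n (e : rel 'I_n) d (v : 'cV[R]_d) :
  incidence e d *m \mxcol_(j < n) v = 0.
Proof.
rewrite incidence_mul -[RHS]submxcolK; apply: eq_mxcol => j.
rewrite -[RHS]submxcolK; apply: eq_mxcol => k.
by rewrite subrr scaler0 !submxcol0.
Qed.

(** Constant stacks lie in the kernel of the incidence matrix, so the range of its transpose is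
    orthogonal to them. *)
Lemma incidence_tr_sum n (e : rel 'I_n) d
    (w : 'cV[R]_(\sum_(j < n) \sum_(k < n) d)) :
  \sum_j submxcol ((incidence e d)^T *m w) j = 0.
Proof.
apply: dot_ext => v; rewrite -dot_mxcol_const dot_mul trmxK incidence_const.
by rewrite dot0l dot0r.
Qed.

(** The difference across each edge vanishes, and equality propagates along paths. *)
Lemma incidence_consensus n (e : rel 'I_n) d (V : 'I_n -> 'cV[R]_d) :
  undirected_connected e -> incidence e d *m \mxcol_j V j = 0 ->
  forall j k, V j = V k.
Proof.
move=> [_ e_conn] IV j k; have edge i l : e i l -> V i = V l.
  move=> eil; have : Num.sqrt ((e i l)%:R / 2) *: (V i - V l) = 0.
    have := congr1 (fun M => submxcol (submxcol M i) l) IV.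
    by rewrite incidence_mul !mxcolK !submxcol0.
  move/eqP; rewrite eil scaler_eq0 sqrtr_eq0 leNgt divr_gt0//= subr_eq0.
  by move/eqP.
have /connectP[s sP ->] := e_conn j k.
elim: s j sP => //= i s IH j /andP[/edge -> ]; exact: IH.
Qed.

End BlockOperators.

(** * Stacks along a partition of n, and the row partition of the identity *)

Section Stacks.
Context {R : realType} {k n : nat} {d : 'I_k -> nat}.
Variable dn : (\sum_(i < k) d i)%N = n.

Lemma eq_colstack p (B C : forall i, 'M[R]_(d i, p)) :
  (forall i, B i = C i) -> colstack dn B = colstack dn C.
Proof. by move=> /eq_mxcol BC; rewrite /colstack BC. Qed.

Lemma colstack_inj p (B C : forall i, 'M[R]_(d i, p)) :
  colstack dn B = colstack dn C -> forall i, B i = C i.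
Proof.
(* Replacing n by the sum of the block sizes makes the cast trivial. *)
by rewrite /colstack; case: n / dn; rewrite !castmx_id => /eq_mxcolP.
Qed.

Lemma colstack_mul p r (B : forall i, 'M[R]_(d i, p)) (w : 'M[R]_(p, r)) :
  colstack dn B *m w = colstack dn (fun i => B i *m w).
Proof. by rewrite /colstack; case: n / dn; rewrite !castmx_id mxcol_mul. Qed.

Lemma colstackB p (B C : forall i, 'M[R]_(d i, p)) :
  colstack dn B - colstack dn C = colstack dn (fun i => B i - C i).
Proof. by rewrite /colstack; case: n / dn; rewrite !castmx_id mxcolB. Qed.

Lemma tr_colstack_mul p r (B : forall i, 'M[R]_(d i, p))
    (C : forall i, 'M[R]_(d i, r)) :
  (colstack dn B)^T *m colstack dn C = \sum_i (B i)^T *m C i.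
Proof.
rewrite /colstack; case: n / dn; rewrite !castmx_id tr_mxcol.
exact: mul_mxrow_mxcol.
Qed.

Lemma rowstack_mul p r (B : forall i, 'M[R]_(p, d i))
    (C : forall i, 'M[R]_(d i, r)) :
  rowstack dn B *m colstack dn C = \sum_i B i *m C i.
Proof.
rewrite /colstack /rowstack; case: n / dn; rewrite !castmx_id.
exact: mul_mxrow_mxcol.
Qed.

Lemma is_deriv_ge0_colstack (f : forall i, R -> 'cV[R]_(d i)) t
    (v : forall i, 'cV[R]_(d i)) : (forall i, is_deriv_ge0 (f i) t (v i)) ->
  is_deriv_ge0 (fun s => colstack dn (fun i => f i s)) t (colstack dn v).
Proof.
move=> fv; rewrite /colstack; case: n / dn; rewrite castmx_id.
have := is_deriv_ge0_mxcol fv.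
by congr is_deriv_ge0; apply/funext => s; rewrite castmx_id.
Qed.

Variable E : forall i, 'M[R]_(d i, n).
Hypothesis E1 : colstack dn E = 1%:M.

Lemma colstack_proj (w : 'cV[R]_n) : colstack dn (fun i => E i *m w) = w.
Proof. by rewrite -colstack_mul E1 mul1mx. Qed.

Lemma proj_colstack (v : forall i, 'cV[R]_(d i)) i : E i *m colstack dn v = v i.
Proof. exact: (colstack_inj (colstack_proj (colstack dn v)) i). Qed.

Lemma tr_proj_sum (v : forall i, 'cV[R]_(d i)) :
  \sum_i (E i)^T *m v i = colstack dn v.
Proof. by rewrite -tr_colstack_mul E1 trmx1 mul1mx. Qed.

Lemma rowstack_proj p (B : forall i, 'M[R]_(p, d i)) :
  rowstack dn B = \sum_i B i *m E i.
Proof. by rewrite -rowstack_mul E1 mulmx1. Qed.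

End Stacks.

(** * Normal equations and limits of stacked trajectories *)

Section LeastSquares.
Context {R : realType}.

Lemma enorm_sqr n (v : 'cV[R]_n) : enorm v ^+ 2 = dot v v.
Proof.
rewrite sqr_sqrtr; last by apply: sumr_ge0 => i _; exact: sqr_ge0.
by apply: eq_bigr => i _; rewrite expr2.
Qed.

(** Pythagoras: A v - b is the sum of A x - b and A (v - x), which are orthogonal. *)
Lemma normal_equation_least_square m n (A : 'M[R]_(m, n)) b x :
  A^T *m (A *m x - b) = 0 -> least_square_solution A b x.
Proof.
move=> Ax v; rewrite !enorm_sqr.
have -> : A *m v - b = (A *m x - b) + A *m (v - x).
  by rewrite mulmxBr; lincomb.
rewrite !(dotDl (A *m x - b)) !(dotDr _ (A *m (v - x))).
rewrite (dotC (A *m (v - x)) (A *m x - b)) dot_mul Ax dot0l addr0 add0r.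
by rewrite lerDl dot_ge0.
Qed.

Lemma exp_cvg_cvg n (f : R -> 'cV[R]_n) l : exp_cvg f l -> f t @[t --> +oo] --> l.
Proof.
move=> /exp_cvgP fl; apply/cvg_mxP => i j; rewrite ord1.
exact: exp_cvg1_cvg.
Qed.

Lemma cvg_mx_unique m n (f : R -> 'M[R]_(m, n)) (l l' : 'M[R]_(m, n)) :
  f t @[t --> +oo] --> l -> f t @[t --> +oo] --> l' -> l = l'.
Proof.
move=> /cvg_mxP fl /cvg_mxP fl'; apply/matrixP => i j.
exact: cvg_unique (fl i j) (fl' i j).
Qed.

Lemma exp_cvg_mxcol p (q : 'I_p -> nat) (f : forall i, R -> 'cV[R]_(q i))
    (l : forall i, 'cV[R]_(q i)) : (forall i, exp_cvg (f i) (l i)) ->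
  exp_cvg (fun t => \mxcol_i f i t) (\mxcol_i l i).
Proof.
move=> fl; apply/exp_cvgP => k; rewrite mxE.
have /exp_cvgP H := fl (tagnat.sig1 k).
by apply: eq_exp_cvg1 (H (tagnat.sig2 k)) => t _; rewrite mxE.
Qed.

End LeastSquares.

(** * The double-layered network as an instance of the primal-dual system *)

Theorem theorem3 (R : realType) (c : nat) (cs : 'I_c -> nat) (m n : nat)
  (ms : 'I_c -> nat) (ns : forall i : 'I_c, 'I_(cs i) -> nat)
  (Hm : (\sum_(i < c) ms i)%N = m)
  (Hn : forall i : 'I_c, (\sum_(j < cs i) ns i j)%N = n)
  (* data of the linear equation and their partitions *)
  (A : 'M[R]_(m, n)) (Ar : forall i : 'I_c, 'M[R]_(ms i, n))
  (Ab : forall (i : 'I_c) (j : 'I_(cs i)), 'M[R]_(ms i, ns i j))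
  (HA : A = colstack Hm Ar)
  (HAr : forall i : 'I_c, Ar i = rowstack (Hn i) (Ab i))
  (b : 'cV[R]_m) (br : forall i : 'I_c, 'cV[R]_(ms i))
  (bb : forall i : 'I_c, 'I_(cs i) -> 'cV[R]_(ms i))
  (Hb : b = colstack Hm br)
  (Hbr : forall i : 'I_c, br i = \sum_(j < cs i) bb i j)
  (E : forall (i : 'I_c) (j : 'I_(cs i)), 'M[R]_(ns i j, n))
  (HE : forall i : 'I_c, colstack (Hn i) (E i) = 1%:M)
  (* cluster graph and agent graphs *)
  (G : rel 'I_c) (Gi : forall i : 'I_c, rel 'I_(cs i))
  (HG : undirected_connected G)
  (HGi : forall i : 'I_c, undirected_connected (Gi i))
  (* trajectories *)
  (x z : forall (i : 'I_c) (j : 'I_(cs i)), R -> 'cV[R]_(ns i j))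
  (xi y : forall i : 'I_c, 'I_(cs i) -> R -> 'cV[R]_(ms i))
  (Hx : forall (i : 'I_c) (j : 'I_(cs i)) (t : R), 0 <= t ->
    is_deriv_ge0 (x i j) t
      (- ((cs i)%:R *: ((Ab i j)^T *m y i j t)
          - \sum_(k < c | G i k)
              (z i j t - E i j *m colstack (Hn k) (fun l => z k l t)))
       - \sum_(k < c | G i k)
              (x i j t - E i j *m colstack (Hn k) (fun l => x k l t))))
  (Hxi : forall (i : 'I_c) (j : 'I_(cs i)) (t : R), 0 <= t ->
    is_deriv_ge0 (xi i j) t
      (- \sum_(k < cs i | Gi i j k) (y i j t - y i k t)))
  (Hy : forall (i : 'I_c) (j : 'I_(cs i)) (t : R), 0 <= t ->
    y i j t = xi i j t + Ab i j *m x i j t - bb i j)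
  (Hz : forall (i : 'I_c) (j : 'I_(cs i)) (t : R), 0 <= t ->
    is_deriv_ge0 (z i j) t
      ((cs i)%:R *: ((Ab i j)^T *m y i j t)
       - \sum_(k < c | G i k)
              (z i j t - E i j *m colstack (Hn k) (fun l => z k l t))))
  (Hxi0 : forall (i : 'I_c) (j : 'I_(cs i)), xi i j 0 = 0) :
  exists xs : forall (i : 'I_c) (j : 'I_(cs i)), 'cV[R]_(ns i j),
    (forall (i : 'I_c) (j : 'I_(cs i)), exp_cvg (x i j) (xs i j)) /\
    exists xstar : 'cV[R]_n,
      [/\ forall i : 'I_c, colstack (Hn i) (xs i) = xstar,
          \sum_(i < c) (Ar i)^T *m (Ar i *m xstar - br i) = 0,
          least_square_solution A b xstar
        & A *m xstar = b <->
          (\mxcol_(i < c) \mxcol_(j < cs i) y i j t) @[t --> +oo]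
            --> (0 : 'cV[R]_(\sum_(i < c) \sum_(j < cs i) ms i))].
Proof.
(* [D] and [Y] each carry one factor sqrt c_i, so that c_i A_ij^T y_ij comes from D^T Y with the
   same D as in Y = Xi + D X - beta. *)
pose rt i : R := Num.sqrt (cs i)%:R.
have rt2 i : rt i * rt i = (cs i)%:R by rewrite -expr2 sqr_sqrtr.
have rt_neq0 i (j : 'I_(cs i)) : rt i != 0.
  by rewrite gt_eqF// sqrtr_gt0 ltr0n (leq_ltn_trans _ (ltn_ord j)).
pose xb i t := colstack (Hn i) (fun j => x i j t).
pose zb i t := colstack (Hn i) (fun j => z i j t).
pose X t := \mxcol_i xb i t; pose Z t := \mxcol_i zb i t.
pose Y t := \mxcol_i \mxcol_j (rt i *: y i j t).
pose Xi t := \mxcol_i \mxcol_j (rt i *: xi i j t).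
pose beta := \mxcol_i \mxcol_j (rt i *: bb i j).
pose D := blockdiag (fun i => \mxcol_j (rt i *: (Ab i j *m E i j))).
pose GI := blockdiag (fun i => incidence (R := R) (Gi i) (ms i)).
pose H := incidence (R := R) G n.
have DE (v : 'I_c -> 'cV[R]_n) : D *m \mxcol_i v i =
    \mxcol_i \mxcol_j (rt i *: (Ab i j *m (E i j *m v i))).
  rewrite blockdiag_mul; apply: eq_mxcol => i; rewrite mxcol_mul.
  by apply: eq_mxcol => j; rewrite -scalemxAl mulmxA.
have DtE (u : forall i, 'I_(cs i) -> 'cV[R]_(ms i)) :
    D^T *m \mxcol_i \mxcol_j u i j =
    \mxcol_i colstack (Hn i) (fun j => rt i *: ((Ab i j)^T *m u i j)).
  rewrite blockdiag_tr_mul; apply: eq_mxcol => i.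
  rewrite tr_mxcol mul_mxrow_mxcol -(tr_proj_sum (HE i)).
  apply: eq_bigr => j _.
  by rewrite linearZ /= trmx_mul -scalemxAl -scalemxAr mulmxA.
have dX t : 0 <= t -> is_deriv_ge0 X t
    (- (D^T *m Y t - H^T *m (H *m Z t)) - H^T *m (H *m X t)).
  move=> t0; have := is_deriv_ge0_mxcol
    (fun i => is_deriv_ge0_colstack (dn := Hn i) (fun j => Hx i j t t0)).
  congr is_deriv_ge0; rewrite DtE !incidence_laplacian; [|exact: HG.1..].
  rewrite -mxcolB -mxcolN -mxcolB; apply: eq_mxcol => i.
  rewrite -[RHS](colstack_proj (HE i)); apply: eq_colstack => j.
  rewrite !(mulmxBr, mulmxN) proj_colstack// !mulmx_sumr.
  rewrite -scalemxAr scalerA rt2.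
  by congr (- (_ - _) - _); apply: eq_bigr => k _; rewrite mulmxBr proj_colstack.
have dZ t : 0 <= t -> is_deriv_ge0 Z t (D^T *m Y t - H^T *m (H *m Z t)).
  move=> t0; have := is_deriv_ge0_mxcol
    (fun i => is_deriv_ge0_colstack (dn := Hn i) (fun j => Hz i j t t0)).
  congr is_deriv_ge0; rewrite DtE incidence_laplacian; last exact: HG.1.
  rewrite -mxcolB; apply: eq_mxcol => i.
  rewrite -[RHS](colstack_proj (HE i)); apply: eq_colstack => j.
  rewrite mulmxBr proj_colstack// mulmx_sumr.
  rewrite -scalemxAr scalerA rt2.
  by congr (_ - _); apply: eq_bigr => k _; rewrite mulmxBr proj_colstack.
have dXi t : 0 <= t -> is_deriv_ge0 Xi t (- (GI^T *m (GI *m Y t))).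
  move=> t0; have := is_deriv_ge0_mxcol (fun i => is_deriv_ge0_mxcol
    (fun j => is_deriv_ge0Z (a := rt i) (Hxi i j t t0))).
  congr is_deriv_ge0; rewrite blockdiag_mul blockdiag_tr_mul -mxcolN.
  apply: eq_mxcol => i; rewrite incidence_laplacian; last exact: (HGi i).1.
  rewrite -mxcolN; apply: eq_mxcol => j; rewrite scalerN scaler_sumr.
  by congr (- _); apply: eq_bigr => k _; rewrite scalerBr.
have YE t : 0 <= t -> Y t = Xi t + D *m X t - beta.
  move=> t0; rewrite DE -mxcolD -mxcolB; apply: eq_mxcol => i.
  rewrite -mxcolD -mxcolB; apply: eq_mxcol => j.
  by rewrite Hy// proj_colstack// scalerBr scalerDr.
have Xi0 : Xi 0 = 0.
  rewrite -[RHS]submxcolK; apply: eq_mxcol => i.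
  rewrite -[RHS]submxcolK; apply: eq_mxcol => j.
  by rewrite Hxi0 scaler0 !submxcol0.
have [xs [ys [zs [eta [[Xxs Yys] Hxs GIys Dys ysE]]]]] :=
  primal_dual_exp_cvg dX dXi YE dZ Xi0.
have [xstar xsE] : exists v, forall i, submxcol xs i = v.
  have cons := incidence_consensus HG (V := submxcol xs).
  rewrite submxcolK in cons.
  (* Without any cluster, 0 serves as the common value. *)
  have [i0 _|none] := pickP (fun _ : 'I_c => true); last first.
    by exists 0 => i; have := none i.
  by exists (submxcol xs i0) => i; exact: cons.
have {}xsE : xs = \mxcol_(i < c) xstar.
  by rewrite -[xs]submxcolK; exact: eq_mxcol.
pose res i := Ar i *m xstar - br i.
have resE i : res i = \sum_j (Ab i j *m (E i j *m xstar) - bb i j).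
  rewrite /res HAr (rowstack_proj (HE i)) Hbr sumrB mulmx_suml.
  by congr (_ - _); apply: eq_bigr => j _; rewrite mulmxA.
pose yb i j := submxcol (submxcol ys i) j.
have ysK : ys = \mxcol_i \mxcol_j yb i j.
  by rewrite -[LHS]submxcolK; apply: eq_mxcol => i; rewrite submxcolK.
have yb_cons i j k : yb i j = yb i k.
  apply: (incidence_consensus (HGi i)); rewrite /yb submxcolK.
  have := congr1 (fun M => submxcol M i) GIys.
  by rewrite submxcol0 -[in LHS](submxcolK ys) blockdiag_mul mxcolK.
(* Summing over the agents of a cluster removes the contribution of G^T eta and leaves the scaled
   residual. *)
have yb_sum i : \sum_j yb i j = rt i *: res i.
  pose w := (incidence (R := R) (Gi i) (ms i))^T *m
    (submxcol eta i : 'cV_(\sum_(j < cs i) \sum_(k < cs i) ms i)).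
  transitivity (\sum_j (rt i *: (Ab i j *m (E i j *m xstar) - bb i j) -
      submxcol w j)).
    apply: eq_bigr => j _; rewrite /yb ysE xsE DE -(submxcolK eta).
    by rewrite blockdiag_tr_mul !submxcolB !mxcolK scalerBr.
  by rewrite sumrB incidence_tr_sum subr0 resE scaler_sumr.
(* By consensus the sum is c_i times each summand; one factor sqrt c_i cancels. *)
have yb_res i j : rt i *: yb i j = res i.
  apply: (scalerI (rt_neq0 i j)); rewrite scalerA rt2 -yb_sum.
  rewrite (eq_bigr (fun=> yb i j)) => [|k _]; last exact: yb_cons.
  by rewrite sumr_const card_ord scaler_nat.
(* Block i of D^T ys is A_i^T times the residual, and the blocks of D^T ys = H^T zs add up to 0. *)
have normal : \sum_i (Ar i)^T *m res i = 0.
  transitivity (\sum_i submxcol (D^T *m ys) i).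
    apply: eq_bigr => i _; rewrite ysK DtE mxcolK.
    rewrite HAr (rowstack_proj (HE i)) linear_sum /= mulmx_suml -(tr_proj_sum (HE i)).
    apply: eq_bigr => j _.
    by rewrite trmx_mul -mulmxA -(yb_res i j) -!scalemxAr.
  by rewrite Dys; exact: incidence_tr_sum.
exists (fun i j => E i j *m xstar); split.
  move=> i j; have := exp_cvg_mul (E i j) (exp_cvg_submxcol i Xxs).
  rewrite xsE mxcolK; apply: eq_exp_cvg => t _.
  by rewrite mxcolK proj_colstack.
exists xstar; split => //.
- by move=> i; exact: colstack_proj.
- apply: normal_equation_least_square.
  by rewrite HA Hb colstack_mul colstackB tr_colstack_mul.
(* The limit of the unscaled y_ij, so that c_i times it is the residual of cluster i. *)
pose ystar i j := (rt i)^-1 *: yb i j.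
have y_cvg : (\mxcol_(i < c) \mxcol_(j < cs i) y i j t) @[t --> +oo] -->
    \mxcol_(i < c) \mxcol_(j < cs i) ystar i j.
  apply: exp_cvg_cvg; apply: exp_cvg_mxcol => i; apply: exp_cvg_mxcol => j.
  have := exp_cvgZ (rt i)^-1
    (exp_cvg_submxcol j (exp_cvg_submxcol i Yys)).
  apply: eq_exp_cvg => t _.
  by rewrite !mxcolK scalerA mulVf ?scale1r ?(rt_neq0 i j).
have -> : A *m xstar = b <-> forall i, res i = 0.
  rewrite HA Hb colstack_mul; split=> [/colstack_inj AE i|res0].
    by rewrite /res AE subrr.
  by apply: eq_colstack => i; apply/eqP; rewrite -subr_eq0; exact/eqP/res0.
split=> [res0|y0].
  suff -> : 0 = \mxcol_(i < c) \mxcol_(j < cs i) ystar i j by [].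
  rewrite -[LHS]submxcolK; apply: eq_mxcol => i.
  rewrite -[LHS]submxcolK; apply: eq_mxcol => j.
  apply/esym/eqP; rewrite !submxcol0 scaler_eq0; apply/orP; right.
  by have /eqP := yb_res i j; rewrite res0 scaler_eq0 (negbTE (rt_neq0 i j)).
(* In a cluster without agents the residual is an empty sum. *)
move=> i; have [j _|none] := pickP (fun _ : 'I_(cs i) => true); last first.
  by rewrite resE big1// => j _; have := none j.
rewrite -(yb_res i j); have := congr1 (fun M => submxcol (submxcol M i) j)
  (cvg_mx_unique y_cvg y0).
move=> /eqP; rewrite !mxcolK !submxcol0 scaler_eq0 invr_eq0 (negbTE (rt_neq0 i j)).
by move=> /eqP ->; rewrite scaler0.
Qed.
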